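(* There exist a compact metric space $(X,\rho)$ and a continuous flow $\varphi_t$ on $X$ such that $\varphi_t$ has no fixed points, $\varphi_t$ is expansive, $\varphi_t$ has the shadowing property (also called the pseudo-orbit tracing property), and $\varphi_t$ does not have local product structure.
   Context: Let $(X,\rho)$ be a compact metric space and $\varphi_t$ ($t\in\mathbb{R}$) a continuous flow on $X$. Expansive: for any $\varepsilon>0$ there is $\delta>0$ such that for any $x,y\in X$ and any homeomorphism $s:\mathbb{R}\to\mathbb{R}$, if $\rho(\varphi_{s(t)}(y),\varphi_t(x))<\delta$ for all $t\in\mathbb{R}$, then $\varphi_{s(t)}(y)\in\varphi_{[-\varepsilon,\varepsilon]}(\varphi_t(x))$ for all $t\in\mathbb{R}$. Pseudo-orbits and shadowing: for $\delta>0$, a $\delta$-pseudo orbit $(x_i,t_i)_{i=-\infty}^{\infty}$ is a sequence of points $x_i\in X$ and reals $t_i\ge 1$ such that $\rho(\varphi_{t_i}(x_i),x_{i+1})<\delta$ for every $i\in\mathbb{Z}$. Put $s_0=0$, $s_k=t_0+\cdots+t_{k-1}$ for $k>0$, and $s_k=-(t_k+\cdots+t_{-1})$ for $k<0$. The pseudo orbit is $\varepsilon$-traced by the orbit of $y\in X$ if there is an increasing homeomorphism $h:\mathbb{R}\to\mathbb{R}$ with $h(0)=0$ such that $\rho(\varphi_{h(t)}(y),\varphi_{t-s_k}(x_k))<\varepsilon$ for every $k\in\mathbb{Z}$ and every $s_k\le t<s_{k+1}$. The flow has the shadowing property if for every $\varepsilon>0$ there exists $\delta>0$ such that every $\delta$-pseudo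 orbit $(x_i,t_i)_{i=-\infty}^{\infty}$ is $\varepsilon$-traced by the orbit of some $y\in X$. Stable and unstable sets: $W^s(x)=\{y\in X:\rho(\varphi_t(y),\varphi_t(x))\to 0\text{ as }t\to+\infty\}$, $W^u(x)=\{y\in X:\rho(\varphi_t(y),\varphi_t(x))\to 0\text{ as }t\to-\infty\}$, and for $\varepsilon>0$, $W^s_\varepsilon(x)=\{y\in W^s(x):\rho(\varphi_t(y),\varphi_t(x))\le\varepsilon\text{ for all }t\ge 0\}$, $W^u_\varepsilon(x)=\{y\in W^u(x):\rho(\varphi_t(y),\varphi_t(x))\le\varepsilon\text{ for all }t\le 0\}$. Local product structure: for every sufficiently small $\varepsilon>0$ there is $\delta>0$ such that for every $x,y\in X$ with $\rho(x,y)\le\delta$ there is a unique $\theta\in\mathbb{R}$ with $|\theta|\le\varepsilon$ such that the set $W^s_\varepsilon(\varphi_\theta(x))\cap W^u_\varepsilon(y)$ contains exactly one point. *)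

(* Defs.v *)
From HB Require Import structures.
From mathcomp Require Import all_boot all_order all_algebra.
From mathcomp Require Import all_classical all_reals all_analysis.

Set Implicit Arguments.
Unset Strict Implicit.
Unset Printing Implicit Defensive.

Import Order.TTheory GRing.Theory Num.Theory.
Import numFieldNormedType.Exports.

Local Open Scope classical_set_scope.
Local Open Scope ring_scope.

Definition homeomorphism (S T : topologicalType) (f : S -> T) : Prop :=
  continuous f /\
  exists g : T -> S, [/\ cancel f g, cancel g f & continuous g].

Section Flows.
Context {R : realType} {X : metricType R}.
Implicit Types (phi : R -> X -> X) (x y z : X) (e d : R).

Definition continuous_flow phi : Prop :=
  [/\ forall x, phi 0 x = x,
      forall s t x, phi (s + t) x = phi s (phi t x)
    & continuous (fun p : R * X => phi p.1 p.2)].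

Definition fixed_point phi x : Prop := forall t, phi t x = x.

(* The reparametrisation [s] is an arbitrary homeomorphism of the line: neither
   [s 0 = 0] nor monotonicity in a given direction is required. *)
Definition expansive phi : Prop :=
  forall e, 0 < e -> exists2 d, 0 < d &
    forall x y (s : R -> R), homeomorphism s ->
      (forall t, mdist (phi (s t) y) (phi t x) < d) ->
      forall t, [set phi r (phi t x) | r in `[- e, e]] (phi (s t) y).

Definition pseudo_orbit phi d (x : int -> X) (t : int -> R) : Prop :=
  forall i : int, 1 <= t i /\ mdist (phi (t i) (x i)) (x (i + 1)) < d.

(* [Negz n] is the integer -(n+1), so the second branch is
   -(t_{-(n+1)} + ... + t_{-1}). *)
Definition switch_time (t : int -> R) (k : int) : R :=
  match k with
  | Posz n => \sum_(i < n) t (Posz i)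
  | Negz n => - \sum_(i < n.+1) t (Negz i)
  end.

Definition traced phi e (x : int -> X) (t : int -> R) y : Prop :=
  exists h : R -> R,
    [/\ homeomorphism h, {homo h : a b / a < b}, h 0 = 0
      & forall (k : int) (r : R),
          switch_time t k <= r < switch_time t (k + 1) ->
          mdist (phi (h r) y) (phi (r - switch_time t k) (x k)) < e].

Definition shadowing_property phi : Prop :=
  forall e, 0 < e -> exists2 d, 0 < d &
    forall (x : int -> X) (t : int -> R),
      pseudo_orbit phi d x t -> exists y, traced phi e x t y.

Definition stable_set phi x : set X :=
  [set y | mdist (phi t y) (phi t x) @[t --> +oo] --> (0 : R)].

Definition unstable_set phi x : set X :=
  [set y | mdist (phi t y) (phi t x) @[t --> -oo] --> (0 : R)].

Definition local_stable_set phi e x : set X :=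
  [set y | stable_set phi x y /\
           forall t, 0 <= t -> mdist (phi t y) (phi t x) <= e].

Definition local_unstable_set phi e x : set X :=
  [set y | unstable_set phi x y /\
           forall t, t <= 0 -> mdist (phi t y) (phi t x) <= e].

Definition local_product_structure phi : Prop :=
  exists2 e0, 0 < e0 & forall e, 0 < e <= e0 ->
    exists2 d, 0 < d & forall x y, mdist x y <= d ->
      exists! theta : R, `|theta| <= e /\
        exists! z, (local_stable_set phi e (phi theta x) `&`
                    local_unstable_set phi e y) z.

End Flows.

(* Main.v *)
(* The space consists of two circles and one orbit G spiralling from the lower
   circle to the upper one.  An orbit staying close to G at all times crosses
   height 0 together with G, which pins down its phase and gives expansivity.
   A pseudo-orbit can essentially only move upwards, so it is traced by a circle
   if it stays near that circle for ever, and by G otherwise.  At time a the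
   angle of G is a + drift a, where the drift varies so slowly at infinity that
   the flow is continuous, but is unbounded.  Hence G comes arbitrarily close to
   the upper circle without being asymptotic, even after a time shift, to the
   orbit of any point of that circle, which contradicts local product
   structure. *)
Require Import Defs.
From HB Require Import structures.
From mathcomp Require Import all_boot all_order all_algebra.
From mathcomp Require Import all_classical all_reals all_analysis.
From mathcomp Require Import ring lra zify.

Set Implicit Arguments.
Unset Strict Implicit.
Unset Printing Implicit Defensive.

Import Order.TTheory GRing.Theory Num.Theory.
Import numFieldNormedType.Exports.

Local Open Scope classical_set_scope.
Local Open Scope ring_scope.

(** * Distance to the integers, and heights and phases along the spiralling orbit *)

Section RealFunctions.
Context {R : realType}.
Implicit Types a b x y : R.

(** The distance to the nearest integer: the metric of the circle R/Z read on lifts. *)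
Definition zdist x : R := `|x - (Num.floor (x + 2^-1))%:~R|.

Lemma norm_int_lt1 (k : int) : `|k%:~R : R| < 1 -> k = 0.
Proof. by rewrite -intr_norm -[1]/(1%:~R) ltr_int; lia. Qed.

Lemma zdist_int x : exists k : int, zdist x = `|x - k%:~R|.
Proof. by eexists. Qed.

Lemma zdist_le x (k : int) : zdist x <= `|x - k%:~R|.
Proof.
rewrite /zdist; set f := Num.floor _.
have /andP[] : f%:~R <= x + 2^-1 < (f + 1)%:~R by rewrite floor_itv.
rewrite intrD => f1 f2.
have h : `|x - f%:~R| <= 2^-1 by rewrite ler_norml; apply/andP; split; lra.
have [->//|kf] := eqVneq k f.
have : 1 <= `|k%:~R - f%:~R : R|.
  rewrite -intrB -intr_norm -[1]/(1%:~R) ler_int.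
  by have : k - f != 0 by [rewrite subr_eq0]; lia.
have := ler_normD (k%:~R - x) (x - f%:~R).
rewrite addrA subrK (distrC _ x); lra.
Qed.

Lemma zdist_ge0 x : 0 <= zdist x.
Proof. exact: normr_ge0. Qed.

Lemma zdist_le_norm x : zdist x <= `|x|.
Proof. by have := zdist_le x 0; rewrite subr0. Qed.

Lemma zdist0 : zdist 0 = 0.
Proof. by apply/le_anti; rewrite zdist_ge0 andbT; have := zdist_le_norm 0; rewrite normr0. Qed.

Lemma zdistDz x (k : int) : zdist (x + k%:~R) = zdist x.
Proof.
apply/le_anti/andP; split.
  have [l ->] := zdist_int x; rewrite (le_trans (zdist_le _ (l + k)))//.
  by rewrite intrD opprD addrACA subrr addr0.
have [l ->] := zdist_int (x + k%:~R); rewrite (le_trans (zdist_le _ (l - k)))//.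
by rewrite intrB opprB addrA addrAC.
Qed.

Lemma zdistN x : zdist (- x) = zdist x.
Proof.
suff h y : zdist (- y) <= zdist y.
  by apply/le_anti; rewrite h -{1}(opprK x) h.
have [l ->] := zdist_int y; rewrite (le_trans (zdist_le _ (- l)))//.
by rewrite intrN -opprD normrN.
Qed.

Lemma zdistD x y : zdist (x + y) <= zdist x + zdist y.
Proof.
have [k ->] := zdist_int x; have [l ->] := zdist_int y.
rewrite (le_trans (zdist_le _ (k + l)))//.
by rewrite intrD opprD addrACA ler_normD.
Qed.

Lemma zdist_small x : `|x| <= 2^-1 -> zdist x = `|x|.
Proof.
move=> xh; apply/le_anti; rewrite zdist_le_norm /=.
have [k ->] := zdist_int x.
have [->|k0] := eqVneq k 0; first by rewrite subr0.
have : 1 <= `|k%:~R : R| by rewrite -intr_norm -[1]/(1%:~R) ler_int; lia.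
have := ler_normD (k%:~R - x) x; rewrite subrK (distrC _ x); lra.
Qed.

Lemma zdist_eq0P x : zdist x = 0 -> exists k : int, x = k%:~R.
Proof.
by have [k ->] := zdist_int x => /normr0_eq0/eqP; rewrite subr_eq0 => /eqP; exists k.
Qed.

Definition compress x : R := x / (1 + `|x|).

Lemma compressN x : compress (- x) = - compress x.
Proof. by rewrite /compress normrN mulNr. Qed.

Lemma norm_compress x : `|compress x| = 1 - (1 + `|x|)^-1.
Proof.
have x0 : 0 < 1 + `|x| by have := normr_ge0 x; lra.
rewrite /compress normrM normfV (gtr0_norm x0).
by apply: (mulIf (lt0r_neq0 x0)); rewrite mulrBl !mulfVK ?lt0r_neq0// mulVf ?lt0r_neq0//; lra.
Qed.

Lemma compress_lt1 x : `|compress x| < 1.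
Proof.
by rewrite norm_compress ltrBlDr ltrDl invr_gt0; have := normr_ge0 x; lra.
Qed.

Lemma compressB_nneg a b : 0 <= a -> 0 <= b ->
  compress b - compress a = (b - a) / ((1 + a) * (1 + b)).
Proof.
move=> a0 b0; rewrite /compress !ger0_norm//; field.
by apply/andP; split; apply/lt0r_neq0; lra.
Qed.

(** On a half-line the difference has a closed form; opposite signs are handled by cutting at 0. The
    lower bound is what lets the height determine the time with uniform precision on bounded
    ranges. *)
Lemma compressB_bounds a b : a <= b ->
  (b - a) / ((1 + `|a|) * (1 + `|b|)) <= compress b - compress a <= b - a.
Proof.
have P c d : 0 <= c -> c <= d ->
    (d - c) / ((1 + c) * (1 + d)) <= compress d - compress c <= d - c.
  move=> c0 cd; have d0 := le_trans c0 cd; rewrite compressB_nneg// lexx/=.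
  rewrite ler_pdivrMr; last by rewrite mulr_gt0//; lra.
  rewrite ler_peMr; nra.
move=> ab; have [a0|a0] := lerP 0 a.
  by rewrite !ger0_norm ?(le_trans a0 ab)// P.
have [b0|b0] := lerP b 0.
  rewrite !ler0_norm ?(ltW a0)//.
  have := P (- b) (- a); rewrite !compressN !opprK oppr_ge0 lerN2 => /(_ b0 ab).
  by rewrite (addrC (- a)) (addrC (- compress a)) [X in _ / X]mulrC.
have {}b0 := ltW b0; rewrite (ger0_norm b0) (ltr0_norm a0).
have -> : compress a = - compress (- a) by rewrite compressN opprK.
have := P 0 b (lexx _) b0; have := P 0 (- a) (lexx _).
rewrite /(compress 0) mul0r !subr0 addr0 !mul1r => /(_ ltac:(lra)) /andP[h1 h2] /andP[h3 h4].
apply/andP; split; last by lra.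
have i1 : 0 < 1 - a by lra.
have i2 : 0 < 1 + b by lra.
have -> : (b - a) / ((1 - a) * (1 + b)) = b / (1 + b) / (1 - a) + - a / (1 - a) / (1 + b).
  by field; rewrite !lt0r_neq0.
apply: le_trans (_ : b / (1 + b) + - a / (1 - a) <= _); last by rewrite opprK lerD.
by rewrite lerD// ler_pdivrMr// ler_peMr ?divr_ge0//; lra.
Qed.

Lemma compress_inc a b : a < b -> compress a < compress b.
Proof.
move=> ab; have /andP[h _] := compressB_bounds (ltW ab).
rewrite -subr_gt0 (lt_le_trans _ h)// divr_gt0 ?subr_gt0// mulr_gt0//;
 by rewrite ltr_pwDl.
Qed.

Lemma compress_ler a b : (compress a <= compress b) = (a <= b).
Proof. exact: (le_mono compress_inc). Qed.

Lemma compress_ltr a b : (compress a < compress b) = (a < b).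
Proof. by rewrite !ltNge compress_ler. Qed.

Lemma compress_inj : injective compress.
Proof. exact: (inc_inj compress_ler). Qed.

Lemma compress_lip a b : `|compress a - compress b| <= `|a - b|.
Proof.
wlog ab : a b / a <= b => [h|].
  by case: (leP a b) => [/h//|/ltW/h]; rewrite distrC (distrC b).
have /andP[_] := compressB_bounds ab.
by rewrite distrC (distrC a) !ger0_norm ?subr_ge0// compress_ler.
Qed.

Lemma compress_near1 e : 0 < e -> exists2 M, 0 < M & forall x, M <= x -> 1 - compress x < e.
Proof.
move=> e0; exists e^-1; first by rewrite invr_gt0.
move=> x ex; have x0 : 0 < x by rewrite (lt_le_trans _ ex)// invr_gt0.
have s0 : 0 <= compress x by rewrite /compress divr_ge0// ltW.
rewrite -(ger0_norm s0) norm_compress opprB addrC subrK (gtr0_norm x0).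
by rewrite -(invrK e) ltf_pV2 ?posrE ?invr_gt0//; lra.
Qed.

(** This is [sqrt (1 + |x|) - 1] with the sign of [x], rationalised so that oddness is immediate. It
    is unbounded while its slope tends to 0. *)
Definition drift x : R := x / (Num.sqrt (1 + `|x|) + 1).

Lemma driftN x : drift (- x) = - drift x.
Proof. by rewrite /drift normrN mulNr. Qed.

Lemma drift_nneg x : 0 <= x -> drift x = Num.sqrt (1 + x) - 1.
Proof.
move=> x0; rewrite /drift ger0_norm//; set m := Num.sqrt _.
have m0 : 0 <= m by exact: sqrtr_ge0.
have mm : m ^+ 2 = 1 + x by rewrite sqr_sqrtr; lra.
apply: (@mulIf _ (m + 1)); first by apply/lt0r_neq0; lra.
by rewrite mulfVK; [lra|apply/lt0r_neq0; lra].
Qed.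

Lemma driftB_nneg a b : 0 <= a -> a <= b ->
  0 <= drift b - drift a <= (b - a) / Num.sqrt (1 + a).
Proof.
move=> a0 ab; rewrite (drift_nneg a0) (drift_nneg (le_trans a0 ab)).
have -> (x y : R) : x - 1 - (y - 1) = x - y by lra.
have ma : Num.sqrt (1 + a) ^+ 2 = 1 + a by rewrite sqr_sqrtr; lra.
have mb : Num.sqrt (1 + b) ^+ 2 = 1 + b by rewrite sqr_sqrtr; lra.
have a1 : 0 < Num.sqrt (1 + a) by rewrite sqrtr_gt0; lra.
have h : Num.sqrt (1 + a) <= Num.sqrt (1 + b) by rewrite ler_sqrt; lra.
apply/andP; split; first by lra.
rewrite ler_pdivlMr//; nra.
Qed.

Lemma driftB a b : a <= b -> 0 <= drift b - drift a <= b - a.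
Proof.
have P c d : 0 <= c -> c <= d -> 0 <= drift d - drift c <= d - c.
  move=> c0 cd; have /andP[-> h] := driftB_nneg c0 cd.
  rewrite (le_trans h)// ler_pdivrMr; last by rewrite sqrtr_gt0; lra.
  rewrite ler_peMr ?subr_ge0//.
  by rewrite -[leLHS]sqrtr1 ler_sqrt; lra.
move=> ab; have [a0|a0] := lerP 0 a; first exact: P.
have [b0|b0] := lerP b 0.
  by have := P (- b) (- a); rewrite !driftN; lra.
have := P 0 b; have := P 0 (- a); rewrite driftN.
have -> : drift 0 = 0 by rewrite /drift mul0r.
lra.
Qed.

Lemma drift_unbounded K : exists2 x, 0 < x & K < drift x.
Proof.
have K0 := normr_ge0 K; have Kn := ler_norm K.
exists ((`|K| + 2) ^+ 2 - 1); first by nra.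
rewrite drift_nneg; last by nra.
by rewrite [1 + _]addrC subrK sqrtr_sqr ger0_norm; lra.
Qed.

Lemma drift_slow t e : 0 < e ->
  exists2 T, 0 < T & forall a, T <= a -> `|drift (a + t) - drift a| < e.
Proof.
move=> e0; pose K := `|t| / e + 1.
have te : 0 <= `|t| / e by rewrite divr_ge0// ltW.
have tE : `|t| = `|t| / e * e by rewrite mulfVK ?lt0r_neq0.
have P c d : K ^+ 2 <= c -> c <= d -> d - c = `|t| -> `|drift d - drift c| < e.
  move=> cK cd dc; have c0 : 0 <= c by rewrite (le_trans _ cK) ?sqr_ge0.
  have /andP[h1 h2] := driftB_nneg c0 cd.
  rewrite ger0_norm// (le_lt_trans h2)// dc ltr_pdivrMr ?sqrtr_gt0 ?ltr_pwDl//.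
  have : K <= Num.sqrt (1 + c).
    by rewrite -[K]ger0_norm ?addr_ge0// -sqrtr_sqr ler_sqrt; lra.
  by rewrite /K; nra.
(* Beyond this threshold both [a] and [a + t] exceed [K ^+ 2], whatever the sign of [t]. *)
exists (`|t| + K ^+ 2); first by rewrite /K; nra.
move=> a aT; have := normr_ge0 t; have [t0|t0] := lerP 0 t.
  by rewrite ger0_norm// in aT * => _; apply: P; rewrite ?ger0_norm//; lra.
by rewrite ltr0_norm// in aT * => _; rewrite distrC; apply: P; rewrite ?ltr0_norm//; lra.
Qed.

Definition phase x : R := x + drift x.

Lemma phaseN x : phase (- x) = - phase x.
Proof. by rewrite /phase driftN opprD. Qed.

Lemma phaseB a b : a <= b -> b - a <= phase b - phase a <= 2 * (b - a).
Proof. by rewrite /phase => /driftB; lra. Qed.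

Lemma continuous_IVT (f : R -> R) x y v :
  continuous f -> f x <= v <= f y -> exists c, f c = v.
Proof.
move=> fc fv; wlog xy : f x y v fc fv / x <= y => [h|].
  case: (leP x y) => [|/ltW] xy; first exact: h fv xy.
  have [||c] := h (fun t => - f t) y x (- v) _ _ xy.
  - by move=> t; apply: cvgN; exact: fc.
  - by rewrite !lerN2 andbC.
  by move=> /oppr_inj <-; exists c.
have [||c _ <-] := @IVT R f x y v xy; [exact: continuous_subspaceT| |by exists c].
by rewrite ge_min le_max; case/andP: fv => -> ->; rewrite orbT.
Qed.

(** Surjectivity follows from the intermediate value theorem, since growth at rate [c] brackets
    every value; the lower bound also makes the inverse Lipschitz. *)
Lemma bilip_homeomorphism (f : R -> R) (c C : R) : 0 < c ->
  (forall x y, x <= y -> c * (y - x) <= f y - f x <= C * (y - x)) ->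
  homeomorphism f.
Proof.
move=> c0 fB.
have C0 : 0 < C.
  by have := fB 0 1 ler01; rewrite subr0 !mulr1; lra.
have fn x y : c * `|x - y| <= `|f x - f y| <= C * `|x - y|.
  wlog yx : x y / y <= x => [h|].
    by case: (leP y x) => [/h//|/ltW/h]; rewrite distrC (distrC (f _)).
  have := fB y x yx; have : 0 <= c * (x - y) by rewrite mulr_ge0 ?subr_ge0// ltW.
  by move=> h1 h2; rewrite !ger0_norm ?subr_ge0//; lra.
have fc : continuous f.
  move=> x; apply/cvgrPdist_lt => e e0; near=> y.
  have /andP[_] := fn x y.
  move=> /le_lt_trans; apply; rewrite -ltr_pdivlMl// mulrC.
  by near: y; apply: cvgr_dist_lt => //; rewrite divr_gt0.
have fs v : exists x, f x = v.
  pose K := `|v - f 0| / c.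
  have K0 : 0 <= K by rewrite divr_ge0// ltW.
  have KE : `|v - f 0| = c * K by rewrite mulrC mulfVK ?lt0r_neq0.
  have := ler_norm (v - f 0); have := ler_norm (f 0 - v); rewrite distrC KE => h1 h2.
  have := fB 0 K K0; have := fB (- K) 0 ltac:(lra) => h3 h4.
  by apply: (continuous_IVT (x := - K) (y := K) fc); lra.
have [g fg] := choice fs.
have fi : injective f.
  move=> x y fxy; wlog xy : x y fxy / x <= y => [h|].
    by case: (leP x y) => [/h|/ltW/h/esym]; exact.
  by have := fB x y xy; rewrite fxy; apply: contraPeq => xney; nra.
split => //; exists g; split => //; first by move=> x; apply: fi; rewrite fg.
move=> x; apply/cvgrPdist_lt => e e0; near=> y.
have /andP[+ _] := fn (g x) (g y); rewrite !fg.
rewrite -ler_pdivlMl// => /le_lt_trans; apply; rewrite ltr_pdivrMl//.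
by near: y; apply: cvgr_dist_lt => //; rewrite mulr_gt0.
Unshelve. all: by end_near. Qed.

Lemma phase_continuous : continuous phase.
Proof.
by case: (@bilip_homeomorphism phase 1 2) => // x y xy; rewrite mul1r phaseB.
Qed.

Lemma phase_comp_continuous (f : R -> R) :
  continuous f -> continuous (fun t => phase (f t)).
Proof. by move=> fc x; exact: (@continuous_comp _ _ _ f phase x (fc x) (@phase_continuous _)). Qed.

Lemma phase_surj y : exists x, phase x = y.
Proof.
case: (@bilip_homeomorphism phase 1 2) => // [? ? ?|_ [g [_ gK _]]].
  by rewrite mul1r phaseB.
by exists (g y).
Qed.

End RealFunctions.

(** * The flow and the metric on lifts *)

Section Lifts.
Context {R : realType}.
Implicit Types (a b r t e : R) (l : option bool * R).

(* A pair [(Some b, a)] lifts the point with angle [a mod 1] of the circle at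
   height [1] or [-1], and [(None, a)] is the point reached at time [a] by the
   orbit that spirals from the lower circle to the upper one. *)
Definition height l : R :=
  match l.1 with Some true => 1 | Some false => -1 | None => compress l.2 end.

Definition angle l : R := if l.1 is None then phase l.2 else l.2.

Definition advance t l := (l.1, l.2 + t).

Lemma advance0 l : advance 0 l = l.
Proof. by case: l => s a; rewrite /advance addr0. Qed.

Lemma advanceD r t l : advance r (advance t l) = advance (t + r) l.
Proof. by rewrite /advance /= addrA. Qed.

(** The time-reversing symmetry: it exchanges the two circles and transfers results from the upper
    circle to the lower one, and from forward to backward time. *)
Definition flip l := (omap negb l.1, - l.2).

(** The maximum metric of the cylinder [-1,1] x R/Z, pulled back to lifts. *)
Definition ldist l1 l2 : R :=
  Num.max `|height l1 - height l2| (zdist (angle l1 - angle l2)).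

Lemma height_flip l : height (flip l) = - height l.
Proof. by case: l => [[[]|] a]; rewrite /height /= ?opprK ?compressN. Qed.

Lemma angle_flip l : angle (flip l) = - angle l.
Proof. by case: l => [[[]|] a]; rewrite /angle /= ?phaseN. Qed.

Lemma flip_advance t l : flip (advance t l) = advance (- t) (flip l).
Proof. by rewrite /flip /advance /= opprD. Qed.

Lemma ldist_flip l1 l2 : ldist (flip l1) (flip l2) = ldist l1 l2.
Proof.
by rewrite /ldist !height_flip !angle_flip -!opprD normrN zdistN.
Qed.

Lemma height_ge l : -1 <= height l.
Proof.
case: l => [[[]|] a]; rewrite /height /=; try lra.
by have := compress_lt1 a; rewrite ltr_norml => /andP[/ltW].
Qed.

Lemma height_le l : height l <= 1.
Proof. by rewrite -lerN2 -height_flip height_ge. Qed.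

Lemma height_None a : -1 < height (None, a) < 1.
Proof. by have := compress_lt1 a; rewrite ltr_norml. Qed.

Lemma height_between l : -1 < height l < 1 -> exists a, l = (None, a).
Proof.
by case: l => [[[]|] a]; rewrite /height /= ?ltxx ?andbF//; exists a.
Qed.

Lemma ldist_ge0 l1 l2 : 0 <= ldist l1 l2.
Proof. by rewrite le_max normr_ge0. Qed.

Lemma ldist_ltE l1 l2 e : (ldist l1 l2 < e) =
  (`|height l1 - height l2| < e) && (zdist (angle l1 - angle l2) < e).
Proof. by rewrite /ldist gt_max. Qed.

Lemma ldist_leE l1 l2 e : (ldist l1 l2 <= e) =
  (`|height l1 - height l2| <= e) && (zdist (angle l1 - angle l2) <= e).
Proof. by rewrite /ldist ge_max. Qed.

Lemma ldistC l1 l2 : ldist l1 l2 = ldist l2 l1.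
Proof. by rewrite /ldist distrC -zdistN opprB. Qed.

Lemma ldistD l2 l1 l3 : ldist l1 l3 <= ldist l1 l2 + ldist l2 l3.
Proof.
rewrite ldist_leE; apply/andP; split.
  apply: le_trans (ler_distD (height l2) _ _) _.
  by rewrite lerD// le_max lexx.
rewrite -(subrKA (angle l2)); apply: le_trans (zdistD _ _) _.
by rewrite lerD// le_max lexx orbT.
Qed.

Lemma ldist_same s a b : ldist (s, a) (s, b) <= 2 * `|a - b|.
Proof.
have h := normr_ge0 (a - b).
have P : `|phase a - phase b| <= 2 * `|a - b|.
  clear h; wlog ba : a b / b <= a => [H|].
    by case: (leP b a) => [/H//|/ltW/H]; rewrite distrC (distrC b).
  by have := phaseB ba => ?; rewrite !ger0_norm//; lra.
have Q := compress_lip a b.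
rewrite ldist_leE; case: s => [[]|]; rewrite /height /angle /= ?subrr ?normr0 ?mulr_ge0//=.
- by rewrite (le_trans (zdist_le_norm _)) ?ler_peMl// ler1n.
- by rewrite (le_trans (zdist_le_norm _)) ?ler_peMl// ler1n.
- by rewrite (le_trans (zdist_le_norm _))// (le_trans Q)// ler_peMl// ler1n.
Qed.

Lemma ldist_advance s t l : ldist (advance s l) (advance t l) <= 2 * `|s - t|.
Proof.
by rewrite (le_trans (ldist_same _ _ _))// opprD addrACA subrr add0r.
Qed.

(** A height close to that of a bounded time can only be reached on the spiralling orbit, at a
    nearby time. The radius [d] is the least gain of height over a time [e] that [compressB_bounds]
    guarantees in this range. *)
Lemma height_near (K e : R) : 0 < e -> exists2 d, 0 < d & forall a l, `|a| <= K ->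
  `|compress a - height l| < d -> exists2 a', l = (None, a') & `|a - a'| < e.
Proof.
move=> e0; have [K0|K0] := ltP K 0.
  by exists 1 => // a l aK; have := normr_ge0 a; lra.
have d0 : 0 < e / ((1 + K) * (1 + (K + e))) by rewrite divr_gt0// mulr_gt0//; lra.
exists (e / ((1 + K) * (1 + (K + e)))) => // a l aK.
have step (b c : R) : `|b| <= K + e -> `|c| <= K ->
    e / ((1 + K) * (1 + (K + e))) <= e / ((1 + `|c|) * (1 + `|b|)).
  move=> bK cK; have b0 := normr_ge0 b; have c0 := normr_ge0 c.
  rewrite ler_pM2l// lef_pV2 ?posrE ?mulr_gt0//; try lra.
  by rewrite ler_pM//; lra.
have up : `|a + e| <= K + e by rewrite (le_trans (ler_normD _ _))// (ger0_norm (ltW e0)) lerD2r.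
have down : `|a - e| <= K + e by rewrite (le_trans (ler_normB _ _))// (ger0_norm (ltW e0)) lerD2r.
have /andP[h1 _] := @compressB_bounds R a (a + e) ltac:(lra).
have /andP[h2 _] := @compressB_bounds R (a - e) a ltac:(lra).
rewrite addrAC subrr add0r in h1.
rewrite (_ : a - (a - e) = e) ?(mulrC (1 + `|a - e|)) in h2; last by lra.
have {}h1 := le_trans (step _ _ up aK) h1; have {}h2 := le_trans (step _ _ down aK) h2.
have := compress_lt1 (a + e); have := compress_lt1 (a - e); rewrite !ltr_norml => h3 h4.
move: (e / _) d0 h1 h2 => d d0 h1 h2.
case: l => [[[]|] b]; rewrite /height /= => h; [exfalso; lra|exfalso; lra|].
exists b => //; rewrite ltr_norml.
have : compress (a - e) < compress b by lra.
have : compress b < compress (a + e) by lra.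
by rewrite !compress_ltr => h5 h6; apply/andP; split; lra.
Qed.

Lemma angle_advance r r' l : r <= r' ->
  r' - r <= angle (advance r' l) - angle (advance r l) <= 2 * (r' - r).
Proof.
move=> rr; case: l => [[b|] a]; rewrite /angle /=; first by lra.
have := @phaseB R (a + r) (a + r'); rewrite lerD2l => /(_ rr); lra.
Qed.

Lemma height_advance r r' l : r <= r' -> height (advance r l) <= height (advance r' l).
Proof. by case: l => [[[]|] a] rr; rewrite /height //= compress_ler lerD2l. Qed.

(** Near a point of the spiralling orbit, close heights mean close times. Near the upper circle, the
    angular error created in time [t] is an increment of [drift], small by [drift_slow]. *)
Lemma advance_continuous t l e : 0 < e -> exists2 d, 0 < d & forall l',
  ldist l l' < d -> ldist (advance t l) (advance t l') < e.
Proof.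
move=> e0; case: l => s a.
(* The symmetry [flip] reduces the lower circle to the upper one. *)
wlog sf : a s t / s != Some false => [H|].
  case: s => [[]|]; [exact: H| |exact: H].
  have [d d0 dH] := H (- a) (Some true) (- t) isT.
  exists d => // l' l'd; rewrite -ldist_flip !flip_advance; apply: dH.
  by rewrite (_ : (Some true, _) = flip (Some false, a))// ldist_flip.
case: s sf => [[|//] _|_].
- have [T T0 TH] := @drift_slow R t (e / 2) ltac:(lra).
  have [M M0 MH] := @compress_near1 R e e0.
  (* For [b > K], the time [b] is past [T] and [b + t] is past [M]. *)
  pose K := T + M + `|t|.
  have := compress_lt1 K; rewrite ltr_norml => /andP[K1 K2].
  exists (Num.min (e / 2) (1 - compress K)); first by rewrite lt_min; lra.
  move=> [s b]; rewrite ldist_ltE !lt_min; case: s => [[]|]; rewrite /height /angle /=.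
  + move=> h; rewrite ldist_ltE /height /angle /=; apply/andP; split; first by rewrite subrr normr0.
    by rewrite opprD addrACA subrr addr0; lra.
  + by rewrite (_ : 1 - -1 = 2); [rewrite normr_nat; lra|lra].
  + rewrite !(ltr_norml (1 - _)) => h; have Kb : compress K < compress b by lra.
    have Kb' : K < b by rewrite -compress_ltr.
    have t1 := ler_norm t; have t2 := ler_norm (- t); rewrite normrN in t2.
    have := MH (b + t) ltac:(by rewrite /K in Kb'; lra) => hb.
    have := TH b ltac:(by rewrite /K in Kb'; lra) => hd.
    have := compress_lt1 (b + t); rewrite ltr_norml => /andP[_ hb1].
    rewrite ldist_ltE /height /angle /=; apply/andP; split.
      by rewrite ger0_norm; lra.
    rewrite (_ : _ - _ = (a - phase b) - (drift (b + t) - drift b)); last first.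
      by rewrite /phase; lra.
    apply: le_lt_trans (zdistD _ _) _; have := zdist_le_norm (- (drift (b + t) - drift b)).
    by rewrite normrN; lra.
- have [d d0 dH] := height_near `|a| (ltac:(lra) : 0 < e / 2).
  exists d => // l'; rewrite ldist_ltE => /andP[/dH-/(_ (lexx _))[b -> ab] _].
  apply: le_lt_trans (ldist_same _ _ _) _.
  by rewrite opprD addrACA subrr addr0; lra.
Qed.

End Lifts.

Lemma fmap_ultra (T U : Type) (f : T -> U) (F : set_system T) :
  UltraFilter F -> UltraFilter (f @ F).
Proof.
move=> FU; split; first exact: fmap_proper_filter.
move=> G GF FG; apply/seteqP; split => [A GA|]; last exact: FG.
have [//|FnA] := in_ultra_setVsetC (f @^-1` A) FU.
by have [x []] := filter_ex (filterI GA (FG (~` A) FnA)).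
Qed.

(** * The compact metric space and its flow *)

Section Spiral.
Context {R : realType}.
Implicit Types (a b t e : R) (l : option bool * R).

(** The quotient of the lifts by full turns of the circles, encoded by canonical representatives
    with angle in [0,1), so that distance 0 implies equality. *)
Definition spiral := {l : option bool * R | (l.1 != None) ==> (0 <= l.2 < 1)}.

HB.instance Definition _ := Choice.on spiral.

Implicit Types x y : spiral.

Definition normalize l := if l.1 is None then l else (l.1, l.2 - (Num.floor l.2)%:~R).

Lemma normalizeP l : ((normalize l).1 != None) ==> (0 <= (normalize l).2 < 1).
Proof.
case: l => [[s|] a] //=.
by have := floor_itv a; rewrite intrD => /andP[h1 h2]; apply/andP; split; lra.
Qed.

Definition pt l : spiral := exist _ (normalize l) (normalizeP l).

Lemma normalize_id x : normalize (val x) = val x.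
Proof.
case: x => [[[s|] a] //= P]; rewrite /normalize /=; congr pair.
have -> : Num.floor a = 0 by apply/eqP; rewrite floor_eq add0r.
by rewrite subr0.
Qed.

Lemma ptK x : pt (val x) = x.
Proof. by apply: val_inj; rewrite /= normalize_id. Qed.

Lemma angle_normalize l : exists k : int, angle (normalize l) = angle l + k%:~R.
Proof.
case: l => [[s|] a]; last by exists 0; rewrite addr0.
by exists (- Num.floor a); rewrite /angle /= intrN.
Qed.

Lemma height_normalize l : height (normalize l) = height l.
Proof. by case: l => [[[]|] a]. Qed.

Lemma ldist_congr l1 l1' l2 l2' (k k' : int) :
  height l1' = height l1 -> height l2' = height l2 ->
  angle l1' = angle l1 + k%:~R -> angle l2' = angle l2 + k'%:~R ->
  ldist l1' l2' = ldist l1 l2.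
Proof.
rewrite /ldist => -> -> -> ->; congr Num.max.
by rewrite opprD addrACA -intrB zdistDz.
Qed.

Definition spiral_dist x y := ldist (val x) (val y).

Let spiral_distxx x : spiral_dist x x = 0.
Proof. by rewrite /spiral_dist /ldist !subrr normr0 zdist0 maxxx. Qed.

Let spiral_dist_eq0 x y : spiral_dist x y = 0 -> x = y.
Proof.
move=> xy0; have : ldist (val x) (val y) <= 0 by move: xy0; rewrite /spiral_dist => ->.
rewrite ldist_leE => /andP[]; rewrite normr_le0 subr_eq0 => /eqP hxy zxy.
have {}zxy : zdist (angle (val x) - angle (val y)) = 0.
  by apply/le_anti; rewrite zxy zdist_ge0.
apply: val_inj; move: hxy zxy; case: x {xy0} => [[s a] /= P]; case: y => [[s' a'] /= P'].
have circle s0 : (s0 != None) ==> (0 <= a < 1) -> (s0 != None) ==> (0 <= a' < 1) ->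
    s0 != None -> zdist (angle (s0, a) - angle (s0, a')) = 0 -> a = a'.
  case: s0 => //= b h1 h2 _ /zdist_eq0P[k]; rewrite /angle /= => E.
  have : k = 0 by apply: (@norm_int_lt1 R); rewrite -E ltr_norml; lra.
  by move=> k0; move: E; rewrite k0; lra.
have := height_None a; have := height_None a'.
case: s P => [[]|] P; case: s' P' => [[]|] P' //= h1 h2 hE zE;
  try (by exfalso; move: h1 h2 hE; rewrite /height /=; lra).
- by rewrite (circle _ P P' isT zE).
- by rewrite (circle _ P P' isT zE).
- by move: hE; rewrite /height /= => /compress_inj ->.
Qed.

Let spiral_distC x y : spiral_dist x y = spiral_dist y x.
Proof. exact: ldistC. Qed.

Let spiral_distD y x z : spiral_dist x z <= spiral_dist x y + spiral_dist y z.
Proof. exact: ldistD. Qed.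

HB.instance Definition _ := isMetric.Build R spiral
  spiral_distxx spiral_dist_eq0 spiral_distC spiral_distD.

Lemma mdist_pt l1 l2 : mdist (pt l1) (pt l2) = ldist l1 l2.
Proof.
have [k Ek] := angle_normalize l1; have [k' Ek'] := angle_normalize l2.
exact: ldist_congr (height_normalize _) (height_normalize _) Ek Ek'.
Qed.

Lemma pt_ex x : exists l, x = pt l.
Proof. by exists (val x); rewrite ptK. Qed.

Definition spiral_flow t x := pt (advance t (val x)).

(** Normalising before advancing changes the angle by an integer only, which [zdist] does not
    see. *)
Lemma spiral_flow_pt t l : spiral_flow t (pt l) = pt (advance t l).
Proof.
apply: mdist_positivity; rewrite mdist_pt.
have [k Ek] : exists k : int, angle (advance t (normalize l)) = angle (advance t l) + k%:~R.
  case: l => [[s|] a]; last by exists 0; rewrite addr0.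
  by exists (- Num.floor a); rewrite /angle /= intrN addrAC.
rewrite (ldist_congr (l1 := advance t l) (l2 := advance t l) (k := k) (k' := 0) _ _ Ek)//.
- by rewrite -mdist_pt mdistxx.
- by case: l {Ek} => [[[]|] a].
- by rewrite addr0.
Qed.

Lemma spiral_flow_continuous : continuous_flow spiral_flow.
Proof.
split.
- by move=> x; rewrite /spiral_flow advance0 ptK.
- move=> s t x; have [l ->] := pt_ex x; rewrite !spiral_flow_pt.
  by rewrite advanceD addrC.
- case=> t x; apply/metricType_numDomainType.cvgrPdist_lt => e e0 /=.
  have [l lE] := pt_ex x; have [d d0 dH] := advance_continuous t l (ltac:(lra) : 0 < e / 2).
  (* A time error of [e / 4] costs at most [e / 2], because of the factor 2 in [ldist_advance]. *)
  exists ([set s | `|t - s| < e / 4], [set y | mdist x y < d]) => /=.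
    split; first by apply/nbhs_ballP; exists (e / 4) => //=; lra.
    by have := nbhsx_ballx x d d0; rewrite ballEmdist.
  move=> [s y] /= [ts xy]; have [l' l'E] := pt_ex y.
  move: xy; rewrite lE l'E !spiral_flow_pt !mdist_pt => /dH h.
  apply: le_lt_trans (ldistD (advance t l') _ _) _.
  have := ldist_advance t s l'; lra.
Qed.

(** Time 1/2 is half a turn on either circle, and strictly raises the height on the spiralling
    orbit. *)
Lemma spiral_no_fixed_point x : ~ fixed_point spiral_flow x.
Proof.
have [[s a] ->] := pt_ex x; move=> /(_ 2^-1); rewrite spiral_flow_pt.
move=> /(congr1 (mdist^~ (pt (s, a)))); rewrite mdistxx mdist_pt => E.
have : ldist (advance 2^-1 (s, a)) (s, a) <= 0 by rewrite E.
rewrite ldist_leE /height /angle; case: s {E} => [b|] /= /andP[].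
  by move=> _; rewrite addrAC subrr add0r zdist_small; rewrite ger0_norm; lra.
rewrite normr_le0 subr_eq0 => /eqP/compress_inj; lra.
Qed.

Lemma pt_lift_continuous s : continuous (fun a => pt (s, a)).
Proof.
move=> a; apply/metricType_numDomainType.cvgrPdist_lt => e e0; near=> b.
rewrite mdist_pt (le_lt_trans (ldist_same _ _ _))// -ltr_pdivlMl// mulrC.
by near: b; apply: cvgr_dist_lt => //; rewrite divr_gt0.
Unshelve. all: by end_near. Qed.

(** An ultrafilter contains a circle, a compact arc of the spiralling orbit, or every tail at one
    end of it. Circles and arcs are images of segments; in the last case the projection to the
    circle converges, and the ultrafilter has the same limit. *)
Lemma spiral_compact : compact [set: spiral].
Proof.
have arc s a b : compact ((fun a => pt (s, a)) @` `[a, b]).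
  apply: (@continuous_compact _ _ (fun a => pt (s, a))); last exact: segment_compact.
  exact/continuous_subspaceT/pt_lift_continuous.
rewrite compact_ultra => F FU _; rewrite setTI.
have arc_cvg s a b (G : set_system spiral) : UltraFilter G ->
    G ((fun a => pt (s, a)) @` `[a, b]) -> exists p : spiral, G --> p.
  by move=> GU Gab; have := arc s a b; rewrite compact_ultra => /(_ G GU Gab)[p [_ Gp]]; exists p.
have circle_cvg (b : bool) (G : set_system spiral) : UltraFilter G ->
    G (range (fun a => pt (Some b, a))) -> exists p : spiral, G --> p.
  move=> GU Gb; apply: (@arc_cvg (Some b) 0 1 G GU); apply: filterS Gb => _ [a _ <-].
  exists (normalize (Some b, a)).2; last by rewrite -[RHS]ptK.
  by have := normalizeP (Some b, a); rewrite /= in_itv /= => /andP[-> /ltW].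
(* Along an end of the spiralling orbit, points are asymptotic to the points of
   the corresponding circle with the same angle. *)
pose tail (b : bool) K := [set pt (None, a) | a in [set a : R | K <= if b then a else - a]].
have tail_cvg (b : bool) : (forall K, F (tail b K)) -> exists p : spiral, F --> p.
  move=> Ftail; pose c x := pt (Some b, angle (val x)).
  have [|p cp] := circle_cvg b (c @ F) (fmap_ultra c FU).
    by apply: (@filterS _ F _ _ (c @^-1` _) _ (Ftail 0)) => x _; exists (angle (val x)).
  exists p; apply/metricType_numDomainType.fcvgrPdist_lt => e e0.
  have [K K0 KH] := @compress_near1 R (e / 2) ltac:(lra).
  move/metricType_numDomainType.cvgrPdist_lt: cp => /(_ (e / 2) ltac:(lra)) cp.
  apply: filterS2 cp (Ftail K) => _ /[swap] -[a /= Ka <-] pc.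
  apply: le_lt_trans (metric_triangle _ (c (pt (None, a))) _) _.
  rewrite [e]splitr ltrD// mdist_pt ldist_ltE; apply/andP; split; last first.
    by rewrite subrr zdist0; lra.
  have := KH _ Ka; case: b Ka {Ftail c pc circle_cvg} => Ka; rewrite /height /=.
    have := compress_lt1 a; rewrite ltr_norml => h1 h2.
    by rewrite ger0_norm; lra.
  have := compress_lt1 a; rewrite compressN ltr_norml => h1 h2.
  by rewrite ler0_norm; lra.
have [/circle_cvg//|F1] := in_ultra_setVsetC (range (fun a => pt (Some true, a))) FU.
have [/circle_cvg//|F2] := in_ultra_setVsetC (range (fun a => pt (Some false, a))) FU.
have [|Farc] := pselect (exists K, F ((fun a => pt (None, a)) @` `[- K, K])).
  by case=> K; exact: arc_cvg.
have {}Farc K : F (~` ((fun a => pt (None, a)) @` `[- K, K])).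
  have [?|//] := in_ultra_setVsetC ((fun a => pt (None, a)) @` `[- K, K]) FU.
  by case: Farc; exists K.
(* An ultrafilter that avoids every arc [[- K, K]] and contains one half of the orbit contains all
   tails on that side. *)
have [F3|F3] := in_ultra_setVsetC (tail true 0) FU.
  apply: (tail_cvg true) => K; apply: filterS2 F3 (Farc `|K|) => _ [a /= a0 <-] aK.
  exists a => //=; rewrite leNgt; apply/negP => aK'; apply: aK; exists a => //=.
  by rewrite in_itv /=; have := ler_norm K; lra.
apply: (tail_cvg false) => K.
apply: filterS2 (filterI F1 F2) (filterI F3 (Farc `|K|)) => x [] + + [].
have [[[[]|] a] ->] := pt_ex x.
- by move=> + _ _ _; case; exists a.
- by move=> _ + _ _; case; exists a.
move=> _ _ a0 aK; exists a => //=; rewrite leNgt; apply/negP => aK'; apply: aK; exists a => //=.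
rewrite in_itv /=; have := ler_norm K.
have [a0'|a0'] := lerP 0 a; first by case: a0; exists a.
by lra.
Qed.

End Spiral.

(** * Expansivity, and failure of local product structure *)

Section Dynamics.
Context {R : realType}.
Implicit Types (a b t e d : R).

Lemma pt_circle_int (c : bool) a (k : int) : pt (Some c, a + k%:~R) = pt (Some c, a).
Proof.
apply: mdist_positivity; rewrite mdist_pt.
rewrite -(mdistxx (pt (Some c, a))) mdist_pt.
by apply: (ldist_congr (k := k) (k' := 0)) => //; rewrite ?addr0.
Qed.

Lemma spiral_flow_expansive : expansive (@spiral_flow R).
Proof.
(* Precision 1/8 in time gives precision 1/4 in phase, so that at height 0 the integer nearest to
   the phase difference is 0. *)
move=> e e0; have [d1 d10 dH] := @height_near R 0 (8^-1 : R) ltac:(lra).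
pose d := Num.min (Num.min e 4^-1) d1.
have de : d <= e by rewrite /d !ge_min lexx.
have d4 : d <= 4^-1 by rewrite /d !ge_min lexx orbT.
have dd1 : d <= d1 by rewrite /d !ge_min lexx orbT.
have compress0 : compress 0 = 0 :> R by rewrite /compress mul0r.
exists d; first by rewrite /d !lt_min e0 d10; lra.
move=> x y s [sc [s' [_ s'K _]]].
have [[u a] ->] := pt_ex x; have [[v b] ->] := pt_ex y => H.
have {}H t : ldist (v, b + s t) (u, a + t) < d.
  by have := H t; rewrite !spiral_flow_pt mdist_pt.
have {}H t : `|height (v, b + s t) - height (u, a + t)| < d /\
    zdist (angle (v, b + s t) - angle (u, a + t)) < d.
  by have := H t; rewrite ldist_ltE => /andP.
have spread (w w' : R) : `|w - w'| < d -> -(1/2) < w - w' < 1/2.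
  by rewrite ltr_norml; lra.
have close t r : `|r| <= e -> pt (v, b + s t) = pt (u, a + t + r) ->
    [set spiral_flow r (spiral_flow t (pt (u, a))) | r in `[- e, e]]
      (spiral_flow (s t) (pt (v, b))).
  rewrite ler_norml => re E; exists r; first by rewrite /= in_itv.
  by rewrite !spiral_flow_pt E.
case: u v H close => [c|] [c'|] H close t.
- have cc : c' = c.
    have [/spread + _] := H 0.
    by rewrite /height /=; case: c' {H close} => /=; case: c => //= ?; exfalso; lra.
  subst c'; have [_] := H t; rewrite /angle /=; have [k ->] := zdist_int (b + s t - (a + t)) => h.
  apply: (close t (b + s t - (a + t) - k%:~R)); first by rewrite (le_trans _ de)// ltW.
  rewrite addrA (addrC (a + t)) subrK -[in LHS](subrK k%:~R (b + s t)).
  by rewrite pt_circle_int.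
(* At time [s' (- b)] the orbit of [y] crosses height 0, at distance 1 from both circles. The next
   case is symmetric, at time [- a]. *)
- have [/spread + _] := H (s' (- b)).
  by rewrite /height /= s'K subrr compress0; case: c {H close} => ?; exfalso; lra.
- have [/spread + _] := H (- a).
  by rewrite /height /= subrr compress0; case: c' {H close} => ?; exfalso; lra.
pose w t := phase (b + s t) - phase (a + t).
have wz r : zdist (w r) < d by have [] := H r.
have wc : continuous (fun t => `|w t|).
  move=> r; apply: cvg_norm; apply: cvgB.
    by apply: (@phase_comp_continuous R (fun t => b + s t)) => ?;
      apply: cvgD; [exact: cvg_cst|exact: sc].
  by apply: (@phase_comp_continuous R (fun t => a + t)) => ?;
    apply: cvgD; [exact: cvg_cst|exact: cvg_id].
have wsmall t0 : `|w t0| <= 2^-1 -> `|w t0| < d by move=> h; rewrite -(zdist_small h).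
have phase_expand a' b' : `|b' - a'| <= `|phase b' - phase a'| <= 2 * `|b' - a'|.
  wlog ab : a' b' / a' <= b' => [h|].
    by case: (leP a' b') => [/h//|/ltW/h]; rewrite distrC (distrC (phase _)).
  by have := phaseB ab => h; rewrite !ger0_norm; lra.
have w0 : `|w (- a)| < d.
  apply: wsmall; have [h _] := H (- a).
  have := dH 0 (None, b + s (- a)); rewrite normr0 lexx.
  rewrite /height /= distrC (lt_le_trans _ dd1); last first.
    by move: h; rewrite /height /= subrr.
  move=> /(_ isT isT)[_ [<-]]; rewrite sub0r normrN => h'.
  have /andP[_] := phase_expand (a + - a) (b + s (- a)).
  by rewrite subrr subr0 /w subrr; lra.
(* [w] stays close to Z by hypothesis, hence close to 0 by connectedness. *)
have wd : `|w t| < d.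
  rewrite ltNge; apply/negP => dw.
  have w2 : 2^-1 < `|w t| by rewrite ltNge; apply/negP => /wsmall; lra.
  have [r wr] : exists r, `|w r| = 4^-1.
    apply: (@continuous_IVT _ _ (- a) t) => //; lra.
  by have := wsmall r; lra.
(* Since [phase] expands distances, the bound on [w t] also bounds the time shift. *)
apply: (close t (b + s t - (a + t))).
  by have /andP[+ _] := phase_expand (a + t) (b + s t); rewrite -/(w t); lra.
by rewrite (addrC (a + t)) subrK.
Qed.

(** For a point [y] high on the spiralling orbit and the point of the upper circle with the same
    angle, a point [z] of the intersection lies on the spiralling orbit because of its past. In the
    future its angle relative to the circle orbit drifts without bound, so it passes through
    half-integers and [z] cannot be asymptotic to that orbit. *)
Lemma spiral_flow_no_local_product : ~ local_product_structure (@spiral_flow R).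
Proof.
case=> e0 e00; pose e := Num.min e0 4^-1.
have e4 : e <= 4^-1 by rewrite ge_min lexx orbT.
move=> /(_ e) [|d d0]; first by rewrite ge_min lexx lt_min e00 /=; lra.
have [M M0 MH] := @compress_near1 R d d0.
have cM : 0 < compress M by rewrite /compress divr_gt0// ltr_pwDl.
have := compress_lt1 M; rewrite ltr_norml => /andP[_ cM1].
move=> /(_ (pt (Some true, phase M)) (pt (None, M)))[|theta].
  rewrite mdist_pt ldist_leE /height /angle /= subrr zdist0 (ltW d0) andbT.
  by have := MH M (lexx _); rewrite ger0_norm; lra.
move=> [[_ [z [[[Sz _] [Uz Uze]] _]]] _].
have [[s a] zE] := pt_ex z; rewrite {}zE in Sz Uz Uze.
have sN : s = None.
  (* The upper circle is excluded in the far past, when the orbit of [y] is at height at most 0; the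
     lower circle is already too far at time 0. *)
  case: s {Sz} Uz Uze => [[]|//] Uz Uze; exfalso.
    have [B [_ BH]] : \forall t \near -oo, `|0 - mdist (spiral_flow t (pt (Some true, a)))
        (spiral_flow t (pt (None, M)))| < 1.
      by move/cvgrPdist_lt : Uz => /(_ 1 ltr01).
    pose t := Num.min (B - 1) (- M).
    have tM : t <= - M by rewrite ge_min lexx orbT.
    have := BH t; rewrite !spiral_flow_pt mdist_pt sub0r normrN ger0_norm ?ldist_ge0//.
    rewrite ldist_ltE /height /= => /(_ _)/andP[].
      by rewrite /t gt_min; apply/orP; left; lra.
    have : compress (M + t) <= compress 0 by rewrite compress_ler; lra.
    have -> : compress 0 = 0 :> R by rewrite /compress mul0r.
    by move=> h; rewrite ger0_norm; lra.
  have := Uze 0 (lexx _); rewrite !spiral_flow_pt mdist_pt ldist_leE /height /= addr0 => /andP[].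
  by rewrite ler0_norm; lra.
rewrite {}sN in Sz {Uz Uze}.
have [B [_ BH]] : \forall t \near +oo, `|0 - mdist (spiral_flow t (pt (None, a)))
    (spiral_flow t (spiral_flow theta (pt (Some true, phase M))))| < 4^-1.
  by move/cvgrPdist_lt : Sz => /(_ 4^-1 ltac:(lra)).
pose f t := phase (a + t) - (phase M + theta + t).
have fz t : B < t -> zdist (f t) < 4^-1.
  move/BH; rewrite !spiral_flow_pt mdist_pt sub0r normrN ger0_norm ?ldist_ge0//.
  by rewrite ldist_ltE => /andP[].
have fE t : f t = a + drift (a + t) - phase M - theta by rewrite /f {1}/phase; lra.
pose t0 := B + 1.
(* The margin 2 ensures that [f] passes the half-integer [v] chosen below, which is at most
   [f t0 + 3/2]. *)
have [K K0 KH] := @drift_unbounded R (drift (a + t0) + 2).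
pose t1 := Num.max t0 (K - a).
have t01 : t0 <= t1 by rewrite le_max lexx.
have Kt1 : drift K <= drift (a + t1).
  have : K <= a + t1 by rewrite -lerBlDl le_max lexx orbT.
  by move/driftB; lra.
have fc : continuous f.
  move=> r; apply: cvgB; last by apply: cvgD; [exact: cvg_cst|exact: cvg_id].
  by apply: (@phase_comp_continuous R (fun t => a + t)) => ?;
    apply: cvgD; [exact: cvg_cst|exact: cvg_id].
pose v : R := 2^-1 + (Num.floor (f t0) + 1)%:~R.
have /andP[v1 v2] := floor_itv (f t0); rewrite intrD in v2.
have [||c] := @IVT R f t0 t1 v t01.
- exact: continuous_subspaceT.
- have := fE t0; have := fE t1 => h1 h2; rewrite /v intrD ge_min le_max.
  by apply/andP; split; apply/orP; [left|right]; lra.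
rewrite in_itv /= => /andP[tc _] fcv; have := fz c.
rewrite fcv /v zdistDz zdist_small ger0_norm; rewrite /t0 in tc *; lra.
Qed.

End Dynamics.

(** * Gluing bi-Lipschitz pieces along a two-sided sequence of times *)

Section Gluing.
Context {R : realType}.

Lemma switch_timeS (w : int -> R) (k : int) :
  switch_time w (k + 1) = switch_time w k + w k.
Proof.
case: k => [n|[|n]].
- by rewrite (_ : Posz n + 1 = Posz n.+1) /= ?big_ord_recr //; lia.
- by rewrite /= big_ord0 big_ord_recr big_ord0 /= add0r addNr.
- rewrite (_ : Negz n.+1 + 1 = Negz n); last by lia.
  by rewrite /= [in RHS]big_ord_recr /= opprD subrK.
Qed.

Lemma le_int_ex (k l : int) : k <= l -> exists n : nat, l = k + n.
Proof. by move=> kl; exists `|l - k|%N; lia. Qed.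

Context (s : int -> R) (F : int -> R -> R) (c C : R)
  (s_step : forall k, s k + 1 <= s (k + 1)).

Let s_mono (k l : int) : k <= l -> s k <= s l.
Proof.
move=> kl; rewrite -(subrK k l) addrC.
have : 0 <= l - k by lia.
case: (l - k) => // n _; elim: n => [|n IH]; first by rewrite addr0.
by have := s_step (k + n); rewrite (_ : k + n + 1 = k + n.+1); [lra|lia].
Qed.

Let s_locate (r : R) : exists k, s k <= r < s (k + 1).
Proof.
have up (n : nat) k : s k + n%:R <= s (k + n).
  elim: n => [|n IH]; first by rewrite !addr0.
  have := s_step (k + n); rewrite (_ : k + n + 1 = k + n.+1); last by lia.
  by rewrite -natr1; lra.
(* As consecutive breakpoints are at least 1 apart, [N] steps from 0 in either direction go past
   [r]. *)
pose N := (Num.truncn `|r - s 0|).+1.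
have rN : `|r - s 0| < N%:R by rewrite truncnS_gt.
have h1 : s (- N%:Z) <= r.
  have := up N (- N%:Z); rewrite addNr; move: rN; rewrite ltr_norml; lra.
have h2 : r < s (- N%:Z + (N + N)%N).
  have := up N 0; rewrite add0r (_ : - N%:Z + (N + N)%N = N); last by lia.
  by move: rN; rewrite ltr_norml; lra.
elim: (N + N)%N (- N%:Z) h1 h2 => [|n IH] k h1 h2; first by move: h2; rewrite addr0; lra.
have [h|h] := ltP r (s (k + 1)); first by exists k; rewrite h1.
by apply: (IH (k + 1)) => //; rewrite (_ : k + 1 + n = k + n.+1) //; lia.
Qed.

Let s_locate_le (x y : R) k l : s k <= x < s (k + 1) -> s l <= y < s (l + 1) ->
  x <= y -> k <= l.
Proof.
move=> /andP[kx _] /andP[_ ly] xy; rewrite leNgt; apply/negP => lk.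
by have := @s_mono (l + 1) k ltac:(lia); lra.
Qed.

(** By induction on the number of breakpoints between [x] and [y]: cut at the first one after [x],
    where adjacent pieces agree, and add the bounds. *)
Lemma glue_bilip :
  (forall k x y, s k <= x -> x <= y -> y <= s (k + 1) ->
    c * (y - x) <= F k y - F k x <= C * (y - x)) ->
  (forall k, F k (s (k + 1)) = F (k + 1) (s (k + 1))) ->
  exists2 q : R -> R, (forall k r, s k <= r < s (k + 1) -> q r = F k r) &
    forall x y, x <= y -> c * (y - x) <= q y - q x <= C * (y - x).
Proof.
move=> FB Fs; have [kap kapP] := choice s_locate.
have kapE k r : s k <= r < s (k + 1) -> kap r = k.
  by move=> kr; apply/le_anti; rewrite !(s_locate_le (kapP r) kr, s_locate_le kr (kapP r)).
exists (fun r => F (kap r) r) => [k r /kapE->//|x y xy].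
have kxy := s_locate_le (kapP x) (kapP y) xy.
have [n] : exists n : nat, kap y = kap x + n by exists `|kap y - kap x|%N; lia.
elim: n x xy {kxy} => [|n IH] x xy E.
  have /andP[h1 _] := kapP x; have /andP[_ h2] := kapP y.
  by rewrite E addr0 in h2 *; apply: FB => //; apply: ltW.
have /andP[h1 h2] := kapP x; have /andP[h3 _] := kapP y.
pose b := s (kap x + 1).
have by' : b <= y by apply: le_trans h3; apply: s_mono; rewrite E; lia.
have kb : kap b = kap x + 1 by apply: kapE; rewrite lexx /= /b; have := s_step (kap x + 1); lra.
have := IH b by' ltac:(by rewrite kb E; lia).
have := FB (kap x) x b h1 (ltW h2) (lexx _).
by rewrite kb -Fs; lra.
Qed.

End Gluing.

(** * Shadowing *)

Section Shadowing.
Context {R : realType}.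
Implicit Types (l : option bool * R) (M d e r t : R).

(* [Q] is a lift of the angle of the point over [l], and the point of the
   spiralling orbit with lifted angle [Q] is either that point itself, or close
   to the upper circle together with it. *)
Definition synced M l (Q : R) :=
  (exists2 a, l = (None, a) & Q = phase a) \/
  [/\ compress M <= height l, phase M <= Q & exists k : int, Q = angle l + k%:~R].

Lemma phase_inj_le (a b : R) : `|a - b| <= `|phase a - phase b|.
Proof.
wlog ba : a b / b <= a => [h|].
  by case: (leP b a) => [/h//|/ltW/h]; rewrite distrC (distrC (phase _)).
by have := phaseB ba => h; rewrite !ger0_norm; lra.
Qed.

Lemma phase_le (a b : R) : (phase a <= phase b) = (a <= b).
Proof. by apply: le_mono => x y xy; have := phaseB (ltW xy); lra. Qed.

Lemma synced_int M l Q : synced M l Q -> exists k : int, Q = angle l + k%:~R.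
Proof. by case=> [[a -> ->]|[]//]; exists 0; rewrite addr0. Qed.

(** On the spiralling orbit, close phases force close times and hence close heights. Near the upper
    circle, the margin from [M] to [M + 1] absorbs the phase error, so [c] is past [M] and both
    heights are within [e] of 1. *)
Lemma synced_trace M d e l Q r c : d <= 1 -> d <= e ->
  (forall x, M <= x -> 1 - compress x < e) ->
  synced (M + 1) l Q -> 0 <= r ->
  `|phase c - (Q + angle (advance r l) - angle l)| < d ->
  ldist (None, c) (advance r l) < e.
Proof.
move=> d1 de Me lQ r0 cQ; have [k kE] := synced_int lQ.
rewrite ldist_ltE; apply/andP; split; last first.
  rewrite (_ : _ - _ = (phase c - (Q + angle (advance r l) - angle l)) + k%:~R).
    by rewrite zdistDz (le_lt_trans (zdist_le_norm _))//; lra.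
  by rewrite /angle /= kE /angle; lra.
case: lQ => [[a la Qa]|[Ml MQ _]].
  rewrite la /height /=; apply: le_lt_trans (compress_lip _ _) _.
  apply: le_lt_trans (phase_inj_le _ _) _; apply: lt_le_trans de.
  apply: le_lt_trans cQ; rewrite la Qa /angle /=.
  by rewrite (_ : _ - _ = phase c - (phase a + phase (a + r) - phase a))//; lra.
have r1 := @angle_advance R 0 r l r0.
rewrite advance0 in r1; have := @height_advance R 0 r l r0; rewrite advance0 => h1.
have Mc : M <= c.
  rewrite -phase_le; have := @phaseB R M (M + 1) ltac:(lra).
  by move: cQ; rewrite ltr_norml; lra.
have := Me M (lexx _); have := height_le (advance r l); have /andP[_] := height_None c.
have : compress M <= compress c by rewrite compress_ler.
have : compress M <= compress (M + 1) by rewrite compress_ler; lra.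
by rewrite /height /= -/(height (advance r l)) ltr_norml; lra.
Qed.

Definition fine_jump M d := forall a l, `|a| <= M + 1 ->
  `|compress a - height l| < d -> exists2 a', l = (None, a') & `|a - a'| < 8^-1.

(** A jump from beyond time [M + 1] loses less than 1/8 of time. As flowing for time at least 1
    leads from [M] past [M + 1], a pseudo-orbit that starts a segment above [M] never comes back
    below. *)
Lemma height_jump M d l l' : 0 <= M -> fine_jump M d ->
  compress (M + 1) <= height l -> `|height l - height l'| < d -> compress M <= height l'.
Proof.
move=> M0 Md Ml ll'; rewrite leNgt; apply/negP => lM.
have Mlt : compress M < compress (M + 1) by rewrite compress_ltr; lra.
have [||a E] := Md (M + 1) l'; first by rewrite ger0_norm; lra.
  by move: ll'; rewrite !ltr_norml; lra.
rewrite ltr_norml => h; move: lM; rewrite E /height /= compress_ltr; lra.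
Qed.

Lemma height_advance_upper M l t : 1 <= t -> compress M <= height l ->
  compress (M + 1) <= height (advance t l).
Proof.
move=> t1; case: l => [[[]|] a]; rewrite /height /= ?compress_ler => Ml.
- by apply: ltW; have := compress_lt1 (M + 1); rewrite ltr_norml => /andP[].
- by have := compress_lt1 M; rewrite ltr_norml; lra.
- by lra.
Qed.

(** The induction step along the pseudo-orbit. A segment ending before time [M + 1] jumps to a point
    of the spiralling orbit; otherwise the next point is near the upper circle and stays there. The
    second conclusion restores the lower height bound for the next step. *)
Lemma synced_step M d l t l' Q (j : R) (k : int) :
  0 <= M -> d <= 4^-1 -> fine_jump M d -> 1 <= t ->
  synced M l Q -> compress (- M) <= height (advance t l) ->
  ldist (advance t l) l' < d -> `|j| < d ->
  angle l' = angle (advance t l) + j + k%:~R ->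
  synced M l' (Q + (angle (advance t l) - angle l + j)) /\
  (forall t', 1 <= t' -> compress (- M) <= height (advance t' l')).
Proof.
move=> M0 d4 Md t1 lQ tl; rewrite ldist_ltE => /andP[hl' _] jd lk.
have t0 : 0 <= t by lra.
have := jd; rewrite ltr_norml => jd'.
have upper : compress M <= height l' ->
    forall t', 1 <= t' -> compress (- M) <= height (advance t' l').
  move=> Ml' t' t'1; have := @height_advance R 0 t' l' ltac:(lra).
  rewrite advance0.
  by have : compress (- M) <= compress M by [rewrite compress_ler; lra]; lra.
have [q qE] := synced_int lQ.
have lint : exists k : int, Q + (angle (advance t l) - angle l + j) = angle l' + k%:~R.
  by exists (q - k); rewrite lk qE intrB; lra.
case: lQ => [[a la Qa]|[Ml MQ _]]; last first.
  have Ml' : compress M <= height l'.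
    exact: (height_jump M0 Md) (height_advance_upper t1 Ml) hl'.
  split; last exact: upper.
  right; split => //; have := @angle_advance R 0 t l t0.
  by rewrite advance0; lra.
rewrite {}la {}Qa {l qE} /height /angle /= in tl hl' lk lint *.
rewrite compress_ler in tl.
have [aM|aM] := leP (a + t) (M + 1).
  have [|a' l'E] := Md (a + t) l' _ hl'; first by rewrite ler_norml; lra.
  rewrite ltr_norml => aa'; rewrite {}l'E /= {upper hl' lint} in lk *.
  split; last by move=> t' t'1; rewrite compress_ler; lra.
  left; exists a' => //.
  have pa : `|phase a' - phase (a + t)| <= 4^-1.
    rewrite ler_norml; case: (leP a' (a + t)) => [|/ltW] /phaseB; lra.
  (* The phase moves by at most 1/4 and [j] is smaller than 1/4, so no full turn is possible. *)
  have k0 : k = 0.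
    move: pa; rewrite lk ler_norml => pa.
    by apply: (@norm_int_lt1 R); rewrite ltr_norml; lra.
  by rewrite lk k0; lra.
have Ml' : compress M <= height l'.
  by apply: (@height_jump M d (None, a + t)) => //; rewrite /height /= compress_ler ltW.
split; last exact: upper.
right; split => //.
by have := @phaseB R M (a + t) ltac:(lra); lra.
Qed.

(** Starting at [pt (v, g 0)] and subtracting [g 0] gives a reparametrisation fixing 0. The
    constants fit slopes in [1/2, 3], also after division by a slope of [phase], which is in
    [1, 2]. *)
Lemma trace_by_lift e (x : int -> spiral) (t : int -> R) (v : option bool) (g : R -> R) :
  (forall x y, x <= y -> 4^-1 * (y - x) <= g y - g x <= 3 * (y - x)) ->
  (forall k r, switch_time t k <= r < switch_time t (k + 1) ->
    ldist (v, g r) (advance (r - switch_time t k) (val (x k))) < e) ->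
  exists y, traced (@spiral_flow R) e x t y.
Proof.
move=> gB gx; exists (pt (v, g 0)), (fun r => g r - g 0); split.
- apply: (@bilip_homeomorphism R _ 4^-1 3) => [|a b /gB]; first by rewrite invr_gt0.
  by rewrite opprB addrA subrK.
- by move=> a b ab; have := gB a b (ltW ab); lra.
- by rewrite subrr.
move=> k r kr; rewrite spiral_flow_pt /spiral_flow mdist_pt.
by rewrite /advance /= addrC subrK; exact: gx.
Qed.

Lemma spiral_flow_shadowing : shadowing_property (@spiral_flow R).
Proof.
move=> e e0; have [M0 M00 M0e] := @compress_near1 R e e0.
pose M := M0 + 1; have Mpos : 0 < M by rewrite /M; lra.
have [d1 d10 dH] := @height_near R (M + 1) 8^-1 ltac:(lra).
pose d := Num.min (Num.min e 4^-1) d1.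
have de : d <= e by rewrite /d !ge_min lexx.
have d4 : d <= 4^-1 by rewrite /d !ge_min lexx orbT.
have dd1 : d <= d1 by rewrite /d !ge_min lexx orbT.
have d0 : 0 < d by rewrite /d !lt_min e0 d10; lra.
have dfine : fine_jump M d.
  by move=> a l aM h; apply: dH => //; apply: lt_le_trans dd1.
exists d => // x t xt; have t1 k : 1 <= t k by have [] := xt k.
pose st k := val (x k); pose en k := advance (t k) (st k).
have jump k : ldist (en k) (st (k + 1)) < d.
  have [_] := xt k; rewrite -{1}[x k]ptK -{1}[x (k + 1)]ptK.
  by rewrite spiral_flow_pt mdist_pt.
have angle_jump k : exists jm : R * int, `|jm.1| < d /\
    angle (st (k + 1)) = angle (en k) + jm.1 + jm.2%:~R.
  have := jump k; rewrite ldistC ldist_ltE => /andP[_].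
  have [m ->] := zdist_int (angle (st (k + 1)) - angle (en k)) => h.
  by exists (angle (st (k + 1)) - angle (en k) - m%:~R, m); split => //=; lra.
have [jm jmP] := choice angle_jump.
pose j k := (jm k).1; have jd k : `|j k| < d by have [] := jmP k.
have jE k : angle (st (k + 1)) = angle (en k) + j k + (jm k).2%:~R by have [] := jmP k.
pose w k := angle (en k) - angle (st k) + j k.
pose S k := switch_time t k.
have SS k : S (k + 1) = S k + t k by exact: switch_timeS.
(* Here [switch_time] is just a signed sum over the integers: [Q C k] is the lifted angle at the
   start of segment [k]. *)
pose Q (C : R) k := C + switch_time w k.
have QS C k : Q C (k + 1) = Q C k + w k by rewrite /Q switch_timeS addrA.
(* The angular jump [j k] is spread linearly over segment [k], which makes the lifted angle
   continuous. *)
pose track C k r := Q C k + angle (advance (r - S k) (st k)) - angle (st k)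
  + j k * ((r - S k) / t k).
have jfrac k r : S k <= r -> r <= S (k + 1) -> `|j k * ((r - S k) / t k)| < d.
  rewrite SS => h1 h2; have tk : 0 < t k by have := t1 k; lra.
  have f0 : 0 <= (r - S k) / t k by rewrite divr_ge0 ?subr_ge0// ltW.
  have f1 : (r - S k) / t k <= 1 by rewrite ler_pdivrMr//; lra.
  by rewrite normrM (ger0_norm f0) (le_lt_trans _ (jd k))// ler_piMr.
have tracking C : exists2 q : R -> R,
    (forall k r, S k <= r < S (k + 1) -> q r = track C k r) &
    forall a b, a <= b -> 2^-1 * (b - a) <= q b - q a <= 3 * (b - a).
  apply: glue_bilip => [k|k a b ka ab bk|k]; first by rewrite SS; have := t1 k; lra.
    have tk : 0 < t k by have := t1 k; lra.
    have := @angle_advance R (a - S k) (b - S k) (st k) ltac:(lra).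
    have : `|j k * ((b - a) / t k)| <= 4^-1 * (b - a).
      have f0 : 0 <= (b - a) / t k by rewrite divr_ge0 ?subr_ge0// ltW.
      rewrite normrM (ger0_norm f0) ler_pM// ?(le_trans (ltW (jd k)))//.
      by rewrite ler_pdivrMr// ler_peMr// subr_ge0.
    have -> : j k * ((b - a) / t k) = j k * ((b - S k) / t k) - j k * ((a - S k) / t k).
      by rewrite -mulrBr -mulrBl; congr (_ * (_ / _)); lra.
    by rewrite ler_norml /track; lra.
  have tk : t k != 0 by apply/lt0r_neq0; have := t1 k; lra.
  have Sk : S (k + 1) - S k = t k by rewrite SS; lra.
  rewrite /track Sk subrr advance0 mul0r mulr0 QS divff// /w -/(en k).
  lra.
have Qint C k : (exists m : int, Q C 0 = angle (st 0) + m%:~R) ->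
    exists m : int, Q C k = angle (st k) + m%:~R.
  move=> Q0; elim/int_rect: k => [//|n [m IH]|n [m IH]].
    exists (m - (jm n).2); have := QS C n; have := jE n.
    by rewrite (_ : Posz n + 1 = n.+1) /w ?intrB; [lra|clear; lia].
  exists (m + (jm (- n.+1%:Z)).2); have := QS C (- n.+1%:Z); have := jE (- n.+1%:Z).
  by rewrite (_ : - n.+1%:Z + 1 = - n%:Z) /w ?intrD; [lra|clear; lia].
(* A circle orbit can follow the tracked angle exactly, so only the heights have to be
   controlled. *)
have circle (b : bool) : (forall k r, 0 <= r <= t k ->
    `|height (Some b, 0) - height (advance r (st k))| < e) ->
    exists y, traced (@spiral_flow R) e x t y.
  move=> hb; have [q qE qB] := tracking (angle (st 0)).
  apply: (@trace_by_lift e x t (Some b) q) => [a c /[dup] ac /qB|k r kr]; first by lra.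
  have Sk : S k <= r < S (k + 1) by [].
  have /andP[Sk1 Sk2] := Sk; rewrite SS in Sk2.
  rewrite ldist_ltE; apply/andP; split; first by apply: hb; rewrite -/(S k); lra.
  have [|m mE] := Qint (angle (st 0)) k.
    by exists 0; rewrite /Q /= big_ord0.
  rewrite (qE k r Sk) {1}/angle /= /track mE -/(S k) -/(st k).
  rewrite (_ : _ - _ = j k * ((r - S k) / t k) + m%:~R); last by lra.
  rewrite zdistDz (le_lt_trans (zdist_le_norm _))// (lt_le_trans _ de)// jfrac// SS; lra.
have Mhalf : 2^-1 <= compress M.
  by rewrite /compress ger0_norm ?(ltW Mpos)// ler_pdivlMr /M; lra.
have [up|] := pselect (forall k, compress M <= height (st k)).
  apply: (circle true) => k r /andP[r0 _].
  have := @height_advance R 0 r (st k) r0; rewrite advance0.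
  have := height_le (advance r (st k)); have := up k; have := M0e M ltac:(by rewrite /M; lra).
  by rewrite [height (Some true, 0)]/height /= ltr_norml; lra.
have [down _|/existsNP[k2 /negP] + /existsNP[k1 /negP]] :=
    pselect (forall k, height (en k) <= compress (- M)).
  apply: (circle false) => k r /andP[_ rt].
  have := @height_advance R r (t k) (st k) rt; rewrite -/(en k).
  have := height_ge (advance r (st k)); have := down k; have := M0e M ltac:(by rewrite /M; lra).
  by rewrite [height (Some false, 0)]/height /= compressN ltr_norml; lra.
rewrite -!ltNge => low2 low1.
have low_pred k : height (st (k + 1)) < compress M -> height (st k) < compress M.
  rewrite !ltNge; apply: contra => Mk; have := jump k; rewrite ldist_ltE => /andP[h _].
  exact: (height_jump (ltW Mpos) dfine) (height_advance_upper (t1 k) Mk) h.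
(* If [k2 <= k1], lowness propagates back from [k1] to [k2]. Otherwise go up from [k1] to the first
   segment ending above [compress (- M)]: until then each next start is still low, since
   [compress M] is at least 1/2 and jumps are below 1/4. *)
have [k0 [k0st k0en]] : exists k0, height (st k0) < compress M /\ compress (- M) < height (en k0).
  have [k21|k12] := leP k2 k1.
    exists k2; split => //; have [n nE] := le_int_ex k21.
    rewrite {}nE {k21} in low1; elim: n low1 => [|n IH]; first by rewrite addr0.
    by rewrite (_ : k2 + n.+1 = k2 + n + 1); [move=> /low_pred/IH|clear; lia].
  have [n nE] := le_int_ex (ltW k12).
  rewrite {}nE {k12} in low2; elim: n k1 low1 low2 => [|n IH] k1 low1 low2.
    by exists k1; rewrite addr0 in low2.
  have [h|h] := ltP (compress (- M)) (height (en k1)); first by exists k1.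
  apply: (IH (k1 + 1)); last by rewrite (_ : k1 + 1 + n = k1 + n.+1) //; clear; lia.
  have := jump k1; rewrite ldist_ltE ltr_norml => /andP[+ _].
  by rewrite compressN in h; lra.
have [a aE] : exists a, st k0 = (None, a).
  apply: height_between; have := compress_lt1 M; rewrite ltr_norml => /andP[_ M1].
  move: k0st k0en; rewrite /en; case: (st k0) => [[[]|] a] h1 h2.
  - by move: h1; rewrite /height /=; lra.
  - move: h2; have := compress_lt1 (- M); rewrite ltr_norml /height /=; lra.
  - exact: height_None.
rewrite /en aE /height /= !compress_ltr in k0st k0en.
(* This constant makes the tracked angle at [k0] equal to the phase of the point on the spiralling
   orbit. *)
pose C := phase a - switch_time w k0.
have Qk0 : Q C k0 = phase a by rewrite /Q /C subrK.
have fwd (n : nat) : synced M (st (k0 + n)) (Q C (k0 + n)) /\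
    compress (- M) <= height (en (k0 + n)).
  elim: n => [|n [IH1 IH2]].
    rewrite addr0 Qk0; split; first by left; exists a.
    by rewrite /en aE /height /= compress_ler ltW.
  have [h1 h2] := synced_step (ltW Mpos) d4 dfine (t1 _) IH1 IH2 (jump _) (jd _) (jE _).
  rewrite (_ : k0 + n.+1 = k0 + n + 1); last by clear; lia.
  by rewrite QS; split => //; apply: h2.
have flip_en k : advance (t k) (flip (en k)) = flip (st k).
  by rewrite /en flip_advance advanceD addNr advance0.
(* Under [flip] the reversed pseudo-orbit is again one: its segments start at [flip (en k)] and end
   at [flip (st k)], with the same angular jumps. So [synced_step] also applies backwards from
   [k0]. *)
have bwd (n : nat) : synced M (flip (en (k0 - n%:Z)))
    (- (Q C (k0 - n%:Z) + angle (en (k0 - n%:Z)) - angle (st (k0 - n%:Z)))) /\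
    compress (- M) <= height (flip (st (k0 - n%:Z))).
  elim: n => [|n [IH1 IH2]].
    rewrite subr0 Qk0 /en aE height_flip /height /angle /= compressN lerN2 compress_ler ltW//.
    split => //; left; exists (- (a + t k0)) => //=.
    by rewrite phaseN; lra.
  pose k := k0 - n.+1%:Z; have kE : k0 - n%:Z = k + 1 by rewrite /k; clear; lia.
  rewrite -/k; rewrite {}kE -flip_en in IH1 IH2.
  have := @synced_step M d _ (t (k + 1)) (flip (en k)) _ (j k) (jm k).2
    (ltW Mpos) d4 dfine (t1 _) IH1 IH2.
  rewrite flip_en ldist_flip ldistC !angle_flip => /(_ (jump _) (jd _))[|h1 h2].
    by rewrite jE; lra.
  split; last by rewrite -flip_en; apply: h2.
  by move: h1; congr synced; rewrite QS /w; lra.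
(* The tracing orbit is the spiralling one, at the time whose phase is the tracked angle. *)
have [q qE qB] := tracking C; have [g gE] := choice (fun r => phase_surj (q r)).
apply: (@trace_by_lift e x t None g) => [r r' rr'|k r kr].
  have := qB r r' rr'; rewrite -!gE => h.
  have gg : g r <= g r' by rewrite -phase_le; lra.
  by have := phaseB gg; lra.
have Sk : S k <= r < S (k + 1) by [].
have /andP[Sk1 Sk2] := Sk; have jf := @jfrac k r Sk1 (ltW Sk2); rewrite SS in Sk2.
rewrite -/(S k) -/(st k).
have [kk0|kk0] := leP k0 k.
  have [n kE] := le_int_ex kk0.
  have [] := fwd n; rewrite -kE => sk _.
  apply: (synced_trace (d := d) _ de M0e sk); [lra|lra|].
  by rewrite gE (qE k r Sk) /track (_ : _ - _ = j k * ((r - S k) / t k)); lra.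
(* Before [k0], time is measured backwards from the end of the segment; the phase error is again a
   fraction of [j k]. *)
have [n nE] := le_int_ex (ltW kk0); have kE : k = k0 - n%:Z by rewrite nE addrK.
have [] := bwd n; rewrite -kE => sk _.
rewrite -ldist_flip flip_advance -flip_en advanceD.
apply: (synced_trace (d := d) _ de M0e sk); [lra|lra|].
rewrite -advanceD flip_en -flip_advance !angle_flip phaseN gE (qE k r Sk) /track.
by rewrite (_ : - (_ + _) - _ = - (j k * ((r - S k) / t k))) ?normrN//; ring.
Qed.

End Shadowing.

Theorem theorem1p1 (R : realType) :
  exists (X : metricType R) (phi : R -> X -> X),
    compact [set: X] /\
    continuous_flow phi /\
    (forall x : X, ~ fixed_point phi x) /\
    expansive phi /\
    shadowing_property phi /\
    ~ local_product_structure phi.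
Proof.
exists (spiral : metricType R), spiral_flow; split; first exact: spiral_compact.
split; first exact: spiral_flow_continuous.
split; first exact: spiral_no_fixed_point.
split; first exact: spiral_flow_expansive.
split; first exact: spiral_flow_shadowing.
exact: spiral_flow_no_local_product.
Qed.
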